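(* Let $L$ be a closed linear operator on a complex Hilbert space $H$ satisfying the standing assumptions listed in the context, with linearly independent slow eigenvectors $\hat{x}_1,\dots,\hat{x}_n$, $L\hat{x}_j=\lambda_j\hat{x}_j$. For $x_0\in H$ and $\xi=(\xi_1,\dots,\xi_n)\in\mathbb{C}^n$ let $$\mathcal{E}(x_0,\xi)=\frac12\int_0^\infty\Big\|e^{tL}x_0-e^{tL}\sum_{j=1}^n\xi_j\hat{x}_j\Big\|^2\,dt,$$ and let $G$ be the $n\times n$ matrix with entries $$G_{ij}=\frac{\langle\hat{x}_i,\hat{x}_j\rangle}{\lambda_i+\lambda_j^*},\qquad 1\le i,j\le n.$$ Then for every $x_0\in H$ the function $\xi\mapsto\mathcal{E}(x_0,\xi)$ has a unique minimizer $\xi^{\rm min}(x_0)=\operatorname{arg\,min}_{\xi\in\mathbb{C}^n}\mathcal{E}(x_0,\xi)$, and it is given by $$\xi^{\rm min}_i(x_0)=\sum_{j=1}^n\left[(G^{T})^{-1}\right]_{ij}\,\big\langle (L+\lambda_j^* )^{-1}x_0,\hat{x}_j\big\rangle,\qquad 1\le i\le n.$$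
   Context: $H$ is a complex Hilbert space with inner product $\langle\cdot,\cdot\rangle$, linear in the first argument and conjugate-linear in the second, and norm $\|\cdot\|$. A star denotes complex conjugation of scalars, and $G^T$ is the (non-conjugated) transpose. For a scalar $\mu$, $L+\mu$ means $L+\mu\,\mathrm{Id}$. Standing assumptions on $L$: $L$ is a closed linear operator on $H$ generating a strongly continuous semigroup $(e^{tL})_{t\ge0}$ which is exponentially stable. Its spectrum satisfies $\Re\,\mathrm{spec}(L)<0$ and $\mathrm{spec}(L)=\mathrm{spec}_{\rm ess}(L)\cup\{\lambda_j\}_{1\le j\le n}$, where $n$ is finite, the $\lambda_j$ are isolated eigenvalues of finite multiplicity (counted with multiplicity, ordered so that $\Re\lambda_i\le\Re\lambda_j$ for $i<j$), and every point of the essential spectrum $\mathrm{spec}_{\rm ess}(L)$ (which may be empty) has real part strictly smaller than $\Re\lambda_j$ for all $j$. The restriction of $L$ to the space associated with the eigenvalues $\lambda_j$ is diagonalizable (no nontrivial Jordan blocks), and $\hat{x}_1,\dots,\hat{x}_n$ are corresponding linearly independent eigenvectors, $L\hat{x}_j=\lambda_j\hat{x}_j$ (the ''slow modes''). Their span is called the slow manifold. Since $\Re\,\mathrm{spec}(L)<0$, the number $-\lambda_j^*$ lies in the resolvent set of $L$, so $(L+\lambda_j^* )^{-1}$ is a bounded operator on $H$. *)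

(* Defs.v *)
From HB Require Import structures.
From mathcomp Require Import all_boot all_order all_algebra.
From mathcomp Require Import all_classical all_reals all_analysis.
From mathcomp Require Export complex.

Set Implicit Arguments.
Unset Strict Implicit.
Unset Printing Implicit Defensive.

Import Order.TTheory GRing.Theory Num.Theory.
Import numFieldNormedType.Exports.
Local Open Scope classical_set_scope.
Local Open Scope ring_scope.
Local Open Scope complex_scope.

Section Definitions.
Context {R : realType}.
Local Notation C := R[i].

Definition lin_indep (V : lmodType C) (n : nat) (v : 'I_n -> V) : Prop :=
  forall c : 'I_n -> C, \sum_i c i *: v i = 0 -> forall i, c i = 0.

(* [A] is meant to be a linear subspace. *)
Definition is_basis (V : lmodType C) (A : set V) (n : nat) (v : 'I_n -> V)
    : Prop :=
  [/\ forall i, A (v i), lin_indep v &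
      forall x, A x -> exists c : 'I_n -> C, x = \sum_i c i *: v i].

Definition has_dim (V : lmodType C) (A : set V) (n : nat) : Prop :=
  exists v : 'I_n -> V, is_basis A v.

Definition fin_dim (V : lmodType C) (A : set V) : Prop :=
  exists n, has_dim A n.

Context {H : normedModType C}.

(* A possibly unbounded operator; [opfun] is irrelevant outside [opdom]. *)
Record linop := LinOp {
  opdom : set H;
  opfun :> H -> H;
  opdom0 : opdom 0;
  opdomP : forall (a : C) x y, opdom x -> opdom y -> opdom (a *: x + y);
  opfunP : forall (a : C) x y, opdom x -> opdom y ->
        opfun (a *: x + y) = a *: opfun x + opfun y }.

Definition closed_op (L : linop) : Prop :=
  closed [set p : H * H | opdom L p.1 /\ p.2 = L p.1].

Definition in_resolvent_set (L : linop) (mu : C) : Prop :=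
  (forall y, exists! x, opdom L x /\ L x - mu *: x = y) /\
  (exists M : R, forall x, opdom L x -> `|x| <= M%:C * `|L x - mu *: x|).

Definition spectrum (L : linop) : set C :=
  [set mu | ~ in_resolvent_set L mu].

(* [inv_shift L mu] is (L + mu)^-1; meaningful when - mu is in the resolvent
   set of L. *)
Definition inv_shift (L : linop) (mu : C) (y : H) : H :=
  xget 0 [set x | opdom L x /\ L x + mu *: x = y].

Definition eigenvector (L : linop) (mu : C) (x : H) : Prop :=
  [/\ x != 0, opdom L x & L x = mu *: x].

Definition isolated_in_spectrum (L : linop) (mu : C) : Prop :=
  spectrum L mu /\
  exists2 r : R, 0 < r & forall z, 0 < `|z - mu| < r%:C -> in_resolvent_set L z.

Definition cintegral (A : set R) (f : R -> C) : C :=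
  (\int[lebesgue_measure]_(t in A) complex.Re (f t)) +i*
  (\int[lebesgue_measure]_(t in A) complex.Im (f t)).

(* The range {x | P x = x} of the Riesz spectral projection
     P = (2 pi i)^-1 \oint_(|z - mu| = r) (z - L)^-1 dz
   at an isolated point mu of the spectrum, the integral being taken weakly
   and parametrized by z = mu + w, w = r e^(i theta), dz = i w d theta.
   It does not depend on the admissible radius r. Its dimension is the
   algebraic multiplicity of mu. *)
Definition spectral_subspace (ip : H -> H -> C) (L : linop) (mu : C) : set H :=
  [set x | exists r : R,
    [/\ 0 < r,
        forall z, 0 < `|z - mu| <= r%:C -> in_resolvent_set L z &
        forall y, ip x y = ((2 * pi)^-1)%:C *
          cintegral `[0, 2 * pi] (fun theta =>
            let w : C := r%:C * (cos theta +i* sin theta) in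
            w * ip (- inv_shift L (- (mu + w)) x) y)]].

Definition isolated_eigenvalue_fin_mult (ip : H -> H -> C) (L : linop) (mu : C)
    : Prop :=
  [/\ isolated_in_spectrum L mu, exists x, eigenvector L mu x &
      fin_dim (spectral_subspace ip L mu)].

(* Essential spectrum in the sense of Browder. *)
Definition ess_spectrum (ip : H -> H -> C) (L : linop) : set C :=
  spectrum L `\` [set mu | isolated_eigenvalue_fin_mult ip L mu].

(* The space associated with the points of [range lambda]: the algebraic sum
   of the subspaces associated with each of them. *)
Definition joint_spectral_subspace (ip : H -> H -> C) (L : linop) (n : nat)
    (lambda : 'I_n -> C) : set H :=
  [set x | exists2 u : 'I_n -> H,
     forall j, spectral_subspace ip L (lambda j) (u j) & x = \sum_j u j].

Definition diagonalizable_on (L : linop) (A : set H) : Prop :=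
  exists n (v : 'I_n -> H),
    is_basis A v /\ forall i, exists mu, eigenvector L mu (v i).

(* [T t] is only relevant for [0 <= t]. *)
Definition C0_semigroup (T : R -> H -> H) : Prop :=
  [/\ forall t, 0 <= t -> linear (T t) /\ continuous (T t),
      forall x, T 0 x = x,
      forall s t x, 0 <= s -> 0 <= t -> T (s + t) x = T s (T t x) &
      forall x, T t x @[t --> 0^'+] --> x].

Definition generates (L : linop) (T : R -> H -> H) : Prop :=
  forall x y, (opdom L x /\ L x = y) <->
    (h^-1)%:C *: (T h x - x) @[h --> 0^'+] --> y.

Definition exp_stable (T : R -> H -> H) : Prop :=
  exists M omega : R, 0 < omega /\
    forall t x, 0 <= t -> `|T t x| <= (M * expR (- omega * t))%:C * `|x|.

(* The eigenvalues are repeated in [lambda] according to multiplicity. *)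
Definition slow_spectrum (ip : H -> H -> C) (L : linop) (n : nat)
    (lambda : 'I_n -> C) : Prop :=
  [/\ forall mu, spectrum L mu -> complex.Re mu < 0,
      spectrum L = ess_spectrum ip L `|` range lambda,
      forall j, isolated_eigenvalue_fin_mult ip L (lambda j) /\
        has_dim (spectral_subspace ip L (lambda j))
                #|[pred k | lambda k == lambda j]|,
      forall i j : 'I_n, (i < j)%N ->
        complex.Re (lambda i) <= complex.Re (lambda j) &
      forall mu j, ess_spectrum ip L mu ->
        complex.Re mu < complex.Re (lambda j)].

(* The norm of [H] takes its (real) values in [C]. *)
Definition energy (T : R -> H -> H) (n : nat) (xhat : 'I_n -> H) (x0 : H)
    (xi : 'cV[C]_n) : \bar R :=
  ((2^-1)%:E * \int[lebesgue_measure]_(t in `[0%R, +oo[)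
     (complex.Re `|T t x0 - T t (\sum_j xi j ord0 *: xhat j)| ^+ 2)%:E)%E.

Definition gram (ip : H -> H -> C) (n : nat) (lambda : 'I_n -> C)
    (xhat : 'I_n -> H) : 'M[C]_n :=
  \matrix_(i, j) (ip (xhat i) (xhat j) / (lambda i + (lambda j)^*)).

End Definitions.
Arguments linop {R} H.

Definition is_minimizer {R : realType} (X : Type) (f : X -> \bar R) (x : X)
    : Prop := forall y, (f x <= f y)%E.

(* Main.v *)
(* Write B(x, y) for the integral of <T t x, T t y> over t >= 0, so that twice
   the energy is B(z, z) with z = x0 - sum_j xi_j xhat_j. As
   B(x, x) - B(T h x, T h x) is the integral of |T t x|^2 over [0, h], dividing
   by h and letting h -> 0 gives the Lyapunov equation
   B(L x, y) + B(x, L y) = - <x, y> on the domain of L. With y = xhat_j it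
   becomes B((L + lambda_j^* ) x, xhat_j) = - <x, xhat_j>, hence
   B(xhat_i, xhat_j) = - G_ij and
   B(x0, xhat_j) = - <(L + lambda_j^* )^-1 x0, xhat_j>. The formula for xi^min
   is therefore the system of normal equations B(z, xhat_j) = 0, which
   characterizes the minimizer because B is positive definite. *)

Require Import Defs.
From mathcomp Require Import all_boot all_order all_algebra.
From mathcomp Require Import all_classical all_reals all_analysis.
From mathcomp Require Import measurable_realfun ring lra.
Import Order.TTheory GRing.Theory Num.Theory.
Import numFieldNormedType.Exports.
Local Open Scope classical_set_scope.
Local Open Scope ring_scope.
Local Open Scope complex_scope.

(** * Real-valued norm and real part of the inner product *)

Section RealInnerProduct.
Context {R : realType} {H : normedModType R[i]} (ip : {dot H for Num.conj}).
Hypothesis ip_norm : forall x : H, ip x x = `|x| ^+ 2.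

(** The norm of [H] lives in [R[i]]; its real part makes the order and the limits of [R]
    available. *)
Definition rnorm (x : H) : R := complex.Re `|x|.
Definition rip (x y : H) : R := complex.Re (ip x y).

Lemma rnormE x : `|x| = (rnorm x)%:C.
Proof. by rewrite /rnorm RRe_real// normr_real. Qed.

Lemma rnorm_ge0 x : 0 <= rnorm x.
Proof. by rewrite -ler0c -rnormE. Qed.

Lemma rnorm_eq0 x : (rnorm x == 0) = (x == 0).
Proof. by rewrite -(normr_eq0 x) rnormE -(inj_eq (@complexI R)). Qed.

Lemma rnormZ (a : R[i]) x : rnorm (a *: x) = complex.Re `|a| * rnorm x.
Proof.
apply: complexI; rewrite -rnormE normrZ rnormE.
by rewrite rmorphM /= RRe_real// normr_real.
Qed.

Lemma rnormD x y : rnorm (x + y) <= rnorm x + rnorm y.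
Proof. by rewrite -lecR rmorphD /= -!rnormE ler_normD. Qed.

Lemma rnormN x : rnorm (- x) = rnorm x.
Proof. by rewrite /rnorm normrN. Qed.

Lemma ler_dist_rnorm x y : `|rnorm x - rnorm y| <= rnorm (x - y).
Proof.
rewrite ler_norml; apply/andP; split.
  have := rnormD (y - x) x; rewrite subrK -(rnormN (x - y)) opprB; lra.
have := rnormD (x - y) y; rewrite subrK; lra.
Qed.

Lemma Re_conj (z : R[i]) : complex.Re (Num.conj z) = complex.Re z.
Proof. by case: z. Qed.

Lemma ip_conj x y : ip x y = Num.conj (ip y x).
Proof. by rewrite hermC expr0 mul1r. Qed.

Lemma rip_sym x y : rip x y = rip y x.
Proof. by rewrite /rip ip_conj Re_conj. Qed.

Lemma ripDl x y z : rip (x + y) z = rip x z + rip y z.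
Proof. by rewrite /rip linearDl raddfD. Qed.

Lemma ripZl (a : R) x y : rip (a%:C *: x) y = a * rip x y.
Proof.
rewrite /rip linearZl_LR /=; case: (ip x y) => u v /=.
by rewrite mul0r subr0.
Qed.

Lemma rip_il x y : rip ('i *: x) y = - rip x ('i *: y).
Proof.
rewrite /rip linearZl_LR linearZr_LR /=; case: (ip x y) => u v /=.
ring.
Qed.

(** By conjugate-linearity, ['i] on the right multiplies [ip x y] by [- 'i]. Complex identities thus
    follow from real ones, applied to [y] and to ['i *: y]. *)
Lemma Im_ip x y : complex.Im (ip x y) = rip x ('i *: y).
Proof.
rewrite /rip linearZr_LR /=; case: (ip x y) => u v /=.
ring.
Qed.

Lemma ripxx x : rip x x = rnorm x ^+ 2.
Proof. by rewrite /rip ip_norm rnormE -rmorphXn. Qed.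

Lemma rnorm_sqrD x y :
  rnorm (x + y) ^+ 2 = rnorm x ^+ 2 + 2 * rip x y + rnorm y ^+ 2.
Proof.
rewrite -!ripxx ripDl !(rip_sym _ (x + y)) !ripDl (rip_sym y x); ring.
Qed.

(** Polarization carries continuity in time from the norms of orbits to their inner products. *)
Lemma rip_polar x y :
  rip x y = 4^-1 * (rnorm (x + y) ^+ 2 - rnorm (x - y) ^+ 2).
Proof.
rewrite !rnorm_sqrD rnormN.
have -> : rip x (- y) = - rip x y.
  rewrite rip_sym -(scaleN1r y) -(rmorphN1 (real_complex R)) ripZl mulN1r.
  by rewrite rip_sym.
lra.
Qed.

(** Cauchy-Schwarz, from the nonnegative squared norm of |z| x - |x| z; the lower bound is the upper
    one at [- y]. *)
Lemma rip_bound x y : `|rip x y| <= rnorm x * rnorm y.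
Proof.
have key z : rip x z <= rnorm x * rnorm z.
  have [/eqP|x0] := eqVneq (rnorm x) 0.
    by rewrite rnorm_eq0 => /eqP ->; rewrite /rip linear0l mulr_ge0 ?rnorm_ge0.
  have [/eqP|z0] := eqVneq (rnorm z) 0.
    by rewrite rnorm_eq0 => /eqP ->; rewrite /rip linear0r mulr_ge0 ?rnorm_ge0.
  have xz0 : 0 < rnorm x * rnorm z by rewrite mulr_gt0// lt0r ?x0 ?z0 rnorm_ge0.
  have := sqr_ge0 (rnorm ((rnorm z)%:C *: x + (- rnorm x)%:C *: z)).
  rewrite -ripxx ripDl !(rip_sym _ (_ + _)) !ripDl !ripZl.
  rewrite !(rip_sym _ (_ *: _)) !ripZl.
  rewrite !ripxx (rip_sym z x) => h.
  rewrite -(ler_pM2l xz0); nra.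
rewrite ler_norml key andbT lerNl.
have := key ((-1)%:C *: y); rewrite rip_sym ripZl rnormZ rip_sym.
by rewrite normc_def/= expr0n addr0 sqrtr_sqr normrN1 !mulN1r mul1r.
Qed.

End RealInnerProduct.

(** * Semigroup orbits and their continuity in time *)

Section Orbits.
Context {R : realType} {H : normedModType R[i]} (ip : {dot H for Num.conj}).
Hypothesis ip_norm : forall x : H, ip x x = `|x| ^+ 2.
Context (T : R -> H -> H).
Hypothesis T_semigroup : C0_semigroup T.
Context (M omega : R).
Hypothesis omega_gt0 : 0 < omega.
Hypothesis T_bound : forall (t : R) (x : H), 0 <= t ->
  rnorm (T t x) <= M * expR (- omega * t) * rnorm x.

Local Notation rip := (rip ip).
Local Notation mu := lebesgue_measure.

Lemma semigroupD t x y : 0 <= t -> T t (x + y) = T t x + T t y.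
Proof.
case: T_semigroup => lin _ _ _ t0; have [l _] := lin t t0.
by have := l 1 x y; rewrite !scale1r.
Qed.

Lemma semigroupZ t (a : R[i]) x : 0 <= t -> T t (a *: x) = a *: T t x.
Proof.
case: T_semigroup => lin _ _ _ t0; have [l _] := lin t t0.
have T0 : T t 0 = 0.
  have := l 1 0 0; rewrite !scale1r addr0 => /eqP.
  by rewrite -subr_eq subrr => /eqP.
by have := l a x 0; rewrite !addr0 T0 addr0.
Qed.

Lemma semigroupB t x y : 0 <= t -> T t (x - y) = T t x - T t y.
Proof.
move=> t0; rewrite -(scaleN1r y) -(scaleN1r (T t y)).
by rewrite semigroupD// semigroupZ.
Qed.

Lemma cvg_rnorm_at_right (F : R -> H) (l : H) :
  F t @[t --> 0^'+] --> l -> forall e : R, 0 < e ->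
  \forall t \near 0^'+, rnorm (F t - l) < e.
Proof.
move=> /cvgrPdist_lt Fl e e0.
have e0' : (0 : R[i]) < e%:C by rewrite ltcR.
apply: filterS (Fl _ e0') => t.
by rewrite distrC rnormE ltcR.
Qed.

(** The operator at the smaller time factors out of the difference; its norm is at most |M|, since
    the exponential factor is at most 1. *)
Lemma semigroup_dist s t x : 0 <= s -> 0 <= t ->
  rnorm (T s x - T t x) <= `|M| * rnorm (T `|s - t| x - x).
Proof.
have key : forall u v, 0 <= u <= v ->
    rnorm (T v x - T u x) <= `|M| * rnorm (T (v - u) x - x).
  move=> u v /andP[u0 uv].
  have -> : T v x = T u (T (v - u) x).
    case: T_semigroup => _ _ TD _.
    by rewrite -TD// ?subr_ge0// addrC subrK.
  rewrite -semigroupB//; apply: le_trans (T_bound _ _ u0) _.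
  apply: ler_wpM2r; first exact: rnorm_ge0.
  apply: le_trans (ler_wpM2r (expR_ge0 _) (ler_norm M)) _.
  rewrite ler_piMr// -expR0 ler_expR mulNr oppr_le0 mulr_ge0//.
  exact: ltW.
move=> s0 t0; have [st|/ltW ts] := leP s t.
  rewrite -rnormN opprB distrC (@ger0_norm _ (t - s)) ?subr_ge0//.
  by apply: key; rewrite s0.
by rewrite (@ger0_norm _ (s - t)) ?subr_ge0//; apply: key; rewrite t0.
Qed.

(* [t] is replaced by [`|t|] so that the function is continuous on the whole
   line. *)
Lemma continuous_rnorm_orbit x : continuous (fun t : R => rnorm (T `|t| x)).
Proof.
move=> t; apply/cvgrPdist_lt => e e0.
have e1 : 0 < e / (`|M| + 1) by rewrite divr_gt0// ltr_pwDr.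
case: (T_semigroup) => _ T0 _ /(_ x)/cvg_rnorm_at_right/(_ _ e1) near0.
have [d /= d0 dP] := near0.
near=> s.
apply: le_lt_trans (ler_dist_rnorm _ _) _.
apply: (le_lt_trans (semigroup_dist _ _ _ _ _)); rewrite ?normr_ge0//.
apply: (@le_lt_trans _ _ ((`|M| + 1) * rnorm (T (`| (`|t|) - (`|s|) |) x - x))).
  by apply: ler_wpM2r; rewrite ?rnorm_ge0// lerDl.
rewrite mulrC -ltr_pdivlMr; last by rewrite ltr_pwDr.
(* The limit at [0^'+] says nothing at 0 itself, so equal absolute values are treated apart. *)
have [->|ts] := eqVneq `|t| `|s|.
  by rewrite subrr normr0 T0 subrr /rnorm normr0.
apply: dP; last by rewrite normr_gt0 subr_eq0.
rewrite /= sub0r normrN normr_id; apply: le_lt_trans (ler_dist_dist _ _) _.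
near: s; exact: (nbhsx_ballx t d d0).
Unshelve. all: by end_near. Qed.

Lemma continuous_rip_orbit x y :
  continuous (fun t : R => rip (T `|t| x) (T `|t| y)).
Proof.
have -> : (fun t : R => rip (T `|t| x) (T `|t| y)) =
  (fun t : R =>
     4^-1 * (rnorm (T `|t| (x + y)) ^+ 2 - rnorm (T `|t| (x - y)) ^+ 2)).
  by apply/funext => t; rewrite (rip_polar ip ip_norm) semigroupD// semigroupB.
move=> t; apply: cvgM; first exact: cvg_cst.
by apply: cvgB; rewrite !expr2; apply: cvgM; exact: continuous_rnorm_orbit.
Qed.

(** * Integrability of products of orbits, and the real form that they define *)

Let halfline : set R := `[0, +oo[%classic.

(** The decay M^2 exp(-2 omega t) is expressed through the exponential density of rate 2 omega,
    which is integrable with mass 1; hence the division by 2 omega. *)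
Lemma rip_orbit_bound t x y : halfline t ->
  `|rip (T t x) (T t y)| <=
  M ^+ 2 / (2 * omega) * (rnorm x * rnorm y) * exponential_pdf (2 * omega) t.
Proof.
rewrite /halfline /= in_itv/= andbT => t0.
rewrite exponential_pdfE//; apply: le_trans (rip_bound ip ip_norm _ _) _.
have := ler_pM (rnorm_ge0 _) (rnorm_ge0 _) (T_bound _ x t0) (T_bound _ y t0).
move/le_trans; apply.
have -> : - (2 * omega) * t = (- omega * t) + (- omega * t) by ring.
rewrite expRD le_eqVlt; apply/orP; left; apply/eqP.
by field; rewrite gt_eqF.
Qed.

Lemma two_omega_gt0 : 0 < 2 * omega. Proof. by rewrite mulr_gt0. Qed.

Lemma integrable_exponential_pdf_halfline c :
  mu.-integrable halfline
    (EFin \o (fun t : R => c * exponential_pdf (2 * omega) t)).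
Proof.
apply: (@integrableS _ _ _ _ setT) => //.
  exact: measurable_itv.
apply: (@integrableZl _ _ _ mu setT measurableT c
  (EFin \o exponential_pdf (2 * omega))).
by apply: integrable_exponential_pdf; rewrite ?ltW// two_omega_gt0.
Qed.

Lemma integrable_rip_orbit x y :
  mu.-integrable halfline (EFin \o (fun t : R => rip (T t x) (T t y))).
Proof.
apply: le_integrable (integrable_exponential_pdf_halfline
  (M ^+ 2 / (2 * omega) * (rnorm x * rnorm y))).
- exact: measurable_itv.
- apply/measurable_EFinP.
  apply: (@eq_measurable_fun _ _ _ _ halfline
    (fun t : R => rip (T `|t| x) (T `|t| y))).
    move=> t; rewrite inE /halfline /= in_itv/= andbT => t0.
    by rewrite ger0_norm.
  apply: measurable_funTS; apply: continuous_measurable_fun.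
  exact: continuous_rip_orbit.
- move=> t Dt /=; rewrite lee_fin.
  by apply: le_trans (rip_orbit_bound _ _ _ Dt) _; exact: ler_norm.
Qed.


(** Real part of the form B; B itself is [cform]. *)
Definition bform x y : R := (\int[mu]_(t in halfline) rip (T t x) (T t y))%R.

Lemma bform_sym x y : bform x y = bform y x.
Proof. by apply: eq_Rintegral => t _; rewrite rip_sym. Qed.

Lemma mem_halfline (t : R) : t \in halfline -> 0 <= t.
Proof. by rewrite inE /halfline /= in_itv/= andbT. Qed.

Lemma bformDl x y z : bform (x + y) z = bform x z + bform y z.
Proof.
rewrite /bform -RintegralD//; try exact: integrable_rip_orbit.
  by apply: eq_Rintegral => t /mem_halfline t0; rewrite semigroupD// ripDl.
exact: measurable_itv.
Qed.

Lemma bformZl (a : R) x y : bform (a%:C *: x) y = a * bform x y.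
Proof.
rewrite /bform -RintegralZl//; try exact: integrable_rip_orbit.
  by apply: eq_Rintegral => t /mem_halfline t0; rewrite semigroupZ// ripZl.
exact: measurable_itv.
Qed.

Lemma bform_il x y : bform ('i *: x) y = - bform x ('i *: y).
Proof.
rewrite -[RHS]mulN1r /bform -RintegralZl//; try exact: integrable_rip_orbit.
  apply: eq_Rintegral => t /mem_halfline t0; rewrite !semigroupZ//.
  by rewrite rip_il mulN1r.
exact: measurable_itv.
Qed.

Lemma bform_bound x y :
  `|bform x y| <= M ^+ 2 / (2 * omega) * (rnorm x * rnorm y).
Proof.
have mhalfline : measurable (halfline : set (measurableTypeR R)).
  exact: measurable_itv.
set c := M ^+ 2 / (2 * omega) * (rnorm x * rnorm y).
have ipdf : mu.-integrable halfline
    (EFin \o (fun t : R => c * exponential_pdf (2 * omega) t)).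
  exact: integrable_exponential_pdf_halfline.
rewrite /bform.
apply: (le_trans (le_normr_Rintegral mhalfline (integrable_rip_orbit x y))).
apply: (@le_trans _ _
  (\int[mu]_(t in halfline) (c * exponential_pdf (2 * omega) t))%R).
  apply: le_Rintegral => //.
    exact: (integrable_norm (integrable_rip_orbit x y)).
  by move=> t Dt; exact: rip_orbit_bound.
rewrite /Rintegral.
(* The density vanishes off the half-line, so the integral extends to the whole line, where the mass
   is 1. *)
have -> : (\int[mu]_(t in halfline) (c * exponential_pdf (2 * omega) t)%:E =
   \int[mu]_t (c * exponential_pdf (2 * omega) t)%:E)%E.
  rewrite integral_mkcond; apply: eq_integral => t _.
  rewrite patchE; case: ifPn => // tD.
  by rewrite /exponential_pdf patchE (negPf tD) mulr0.
under eq_integral do rewrite EFinM.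
have c0 : 0 <= c.
  rewrite mulr_ge0 ?(mulr_ge0 (rnorm_ge0 _))// ?rnorm_ge0//.
  by rewrite divr_ge0 ?sqr_ge0// ltW// two_omega_gt0.
rewrite integralZl//=; last first.
  by apply: integrable_exponential_pdf; rewrite ?ltW// two_omega_gt0.
have w0 := two_omega_gt0.
by rewrite integral_exponential_pdf ?mule1// ltW.
Qed.


(** * Decrease of the form along the semigroup, and its definiteness *)

Let sqnorm_orbit x (t : R) : R := rip (T `|t| x) (T `|t| x).

Lemma continuous_sqnorm_orbit x : continuous (sqnorm_orbit x).
Proof. exact: continuous_rip_orbit. Qed.

Lemma sqnorm_orbit_ge0 x t : 0 <= sqnorm_orbit x t.
Proof. by rewrite /sqnorm_orbit (ripxx ip ip_norm) sqr_ge0. Qed.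

Lemma bform_sqnorm_orbit x :
  bform x x = (\int[mu]_(t in halfline) sqnorm_orbit x t)%R.
Proof.
by apply: eq_Rintegral => t /mem_halfline t0; rewrite /sqnorm_orbit ger0_norm.
Qed.

Lemma integrable_sqnorm_orbit x :
  mu.-integrable halfline (EFin \o sqnorm_orbit x).
Proof.
apply: eq_integrable (integrable_rip_orbit x x) => //.
  exact: measurable_itv.
by move=> t /mem_halfline t0 /=; rewrite /sqnorm_orbit ger0_norm.
Qed.

(** By the semigroup law, the orbit of [T h x] is the orbit of [x] advanced by [h]: a change of
    variable. *)
Lemma bform_shift (h : R) x : 0 <= h ->
  bform (T h x) (T h x) = (\int[mu]_(t in `[h, +oo[) sqnorm_orbit x t)%R.
Proof.
move=> h0; rewrite bform_sqnorm_orbit /Rintegral; congr fine.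
have dE : ((shift h : R -> R)^`())%classic = cst 1.
  apply/funext => t; rewrite derive1E.
  exact: (congr1 (@^~ t) (derive_shift 1 h)).
(* The lower limit [h] is displayed as [shift h 0], the form that the substitution rule expects. *)
transitivity
  (\int[mu]_(t in `[shift h 0, +oo[) (sqnorm_orbit x t)%:E)%E; last first.
  by rewrite /= add0r.
rewrite (@increasing_ge0_integration_by_substitutiony _ (shift h)).
- apply: eq_integral => t /mem_halfline t0.
  rewrite dE fctE /= mulr1 /sqnorm_orbit.
  rewrite !ger0_norm ?addr_ge0//.
  by case: T_semigroup => _ _ -> //.
- by move=> u v _ _ uv; rewrite ltrD2r.
- by rewrite dE => u _; exact: cst_continuous.
- by rewrite dE; exact: is_cvg_cst.
- by rewrite dE; exact: is_cvg_cst.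
- split.
    move=> u _.
    by apply: derivableD; [exact: derivable_id|exact: derivable_cst].
  by apply: cvg_at_right_filter; apply: cvgD; [exact: cvg_id|exact: cvg_cst].
- by apply: cvg_addrr.
- by apply: continuous_subspaceT; exact: continuous_sqnorm_orbit.
- by move=> u _; exact: sqnorm_orbit_ge0.
Qed.

Lemma bform_drop x :
  h^-1 * (bform x x - bform (T h x) (T h x)) @[h --> 0^'+] --> rnorm x ^+ 2.
Proof.
(* Integrals start at -1 so that 0 is an interior point, where the fundamental theorem of calculus
   gives a derivative; [sqnorm_orbit] is continuous on negative times too. *)
have if1 (u : R) : mu.-integrable `[-1, u] (EFin \o sqnorm_orbit x).
  apply: continuous_compact_integrable; first exact: segment_compact.
  by apply: continuous_subspaceT; exact: continuous_sqnorm_orbit.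
pose F (y : R) := (\int[mu]_(t in `[(-1), y]) sqnorm_orbit x t)%R.
have [] := @continuous_FTC1_closed _ (sqnorm_orbit x) (-1) 0 1 ltr01 (if1 1)
  (ltrN10 _) (@continuous_sqnorm_orbit x 0).
rewrite -/F => dF F0.
have f0 : sqnorm_orbit x 0 = rnorm x ^+ 2.
  by case: T_semigroup => _ T0 _ _; rewrite /sqnorm_orbit normr0 !T0 ripxx.
rewrite -f0 -F0.
have cF : h^-1 * (F h - F 0) @[h --> 0^'+] --> (F^`())%classic 0.
  have := dF; rewrite /derivable => /cvg_dnbhs_at_right.
  rewrite derive1E /derive.
  apply: cvg_trans; apply: near_eq_cvg; near=> h => /=.
  by rewrite /shift /= [h *: 1]mulr1 addr0.
apply: cvg_trans cF; apply: near_eq_cvg; near=> h.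
have h0 : 0 < h by [].
congr *%R.
(* Both differences are the integral over [[0, h]]: one by cutting the half-line at [h], the other
   by cutting [[-1, h]] at 0. Single endpoints do not change the integrals. *)
rewrite bform_shift ?ltW// bform_sqnorm_orbit.
have := @Rintegral_itvB _ (sqnorm_orbit x) (BLeft (0 : R)) (BInfty _ false) h
  (integrable_sqnorm_orbit x).
rewrite !bnd_simp ltW// => /(_ isT isT).
have i1 : mu.-integrable `]h, +oo[ (EFin \o sqnorm_orbit x).
  apply: integrableS (integrable_sqnorm_orbit x) => //.
    exact: measurable_itv.
  by apply: subset_itvr; rewrite bnd_simp ltW.
rewrite Rintegral_itv_obnd_cbnd// => <-.
rewrite /halfline subKr.
rewrite /F Rintegral_itvB ?bnd_simp ?ltW ?lerN10//.
rewrite Rintegral_itv_obnd_cbnd//.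
apply: integrableS (if1 h) => //.
by apply: subset_itvr; rewrite bnd_simp.
Unshelve. all: by end_near. Qed.

Lemma bform_ge0 x : 0 <= bform x x.
Proof.
rewrite bform_sqnorm_orbit; apply: Rintegral_ge0 => t _.
exact: sqnorm_orbit_ge0.
Qed.

(** If B(x, x) = 0, the quotients of [bform_drop] are nonpositive, hence so is their limit |x|^2. *)
Lemma bform_eq0 x : bform x x = 0 -> x = 0.
Proof.
move=> bx0; apply/eqP; rewrite -rnorm_eq0 -sqrf_eq0 eq_le sqr_ge0 andbT.
apply: (cvgr_to_le (bform_drop x)).
near=> h.
rewrite bx0 sub0r mulrN oppr_le0 mulr_ge0 ?bform_ge0//.
by rewrite invr_ge0 ltW.
Unshelve. all: by end_near. Qed.


(** * The Lyapunov equation, first real and then complex *)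

Lemma bform_sqrD x y :
  bform (x + y) (x + y) = bform x x + 2 * bform x y + bform y y.
Proof.
rewrite bformDl !(bform_sym _ (x + y)) !bformDl (bform_sym y x); ring.
Qed.

Lemma bformZr (a : R) x y : bform x (a%:C *: y) = a * bform x y.
Proof. by rewrite bform_sym bformZl bform_sym. Qed.

Lemma bformDr x y z : bform x (y + z) = bform x y + bform x z.
Proof. by rewrite bform_sym bformDl !(bform_sym x). Qed.

Lemma bformNr x y : bform x (- y) = - bform x y.
Proof.
by rewrite -(scaleN1r y) -(rmorphN1 (real_complex R)) bformZr mulN1r.
Qed.

(** With T h x = x + h w and w close to y, the quotient of [bform_drop] expands as - 2 B(x, w) - h
    B(w, w). Continuity of the form, from [bform_bound], gives the limit - 2 B(x, y). *)
Lemma lyapunov_diag x y : (h^-1)%:C *: (T h x - x) @[h --> 0^'+] --> y ->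
  2 * bform x y = - rnorm x ^+ 2.
Proof.
move=> Txy; apply/eqP; rewrite -subr_eq0 opprK; apply/eqP.
pose w (h : R) := (h^-1)%:C *: (T h x - x).
pose g h := rnorm (w h - y).
have g0 : g h @[h --> 0^'+] --> (0 : R).
  apply/cvgr0Pnorm_lt => e e0.
  apply: filterS (cvg_rnorm_at_right _ _ Txy _ e0) => h.
  by rewrite ger0_norm// rnorm_ge0.
pose K := M ^+ 2 / (2 * omega).
have K0 : 0 <= K by rewrite divr_ge0 ?sqr_ge0// ltW// two_omega_gt0.
pose d h := h^-1 * (bform x x - bform (T h x) (T h x)).
(* Error bound: the first term controls 2 B(x, w - y), the second h B(w, w) through |w| <= |y| +
   g. *)
pose E h :=
  2 * (K * (rnorm x * g h)) + h * (K * ((rnorm y + g h) * (rnorm y + g h))).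
have E0 : E h @[h --> 0^'+] --> (0 : R).
  rewrite [X in _ --> X](_ : 0 =
    2 * (K * (rnorm x * 0)) + 0 * (K * ((rnorm y + 0) * (rnorm y + 0))));
    last by ring.
  have id0 : h @[h --> (0 : R)^'+] --> (0 : R).
    by apply: cvg_at_right_filter; exact: cvg_id.
  apply: cvgD.
    apply: cvgM; first exact: cvg_cst.
    apply: cvgM; first exact: cvg_cst.
    apply: cvgM; first exact: cvg_cst.
    exact: g0.
  apply: cvgM; first exact: id0.
  apply: cvgM; first exact: cvg_cst.
  by apply: cvgM; (apply: cvgD; [exact: cvg_cst|exact: g0]).
have dE : d h @[h --> 0^'+] --> - (2 * bform x y).
  apply/cvgrPdist_le => e e0; near=> h.
  have h0 : 0 < h by [].
  apply: (@le_trans _ _ (E h)); last first.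
    apply: le_trans (ler_norm _) _.
    by near: h; exact: (cvgr0_norm_le _ E0 _ e0).
  have Th : T h x = x + h%:C *: w h.
    by rewrite /w scalerA -rmorphM/= divff ?gt_eqF// scale1r addrC subrK.
  have -> : d h = - (2 * bform x (w h)) - h * bform (w h) (w h).
    rewrite /d; move: (w h) Th => v ->.
    by rewrite bform_sqrD !(bformZr, bformZl); field; rewrite gt_eqF.
  have -> : - (2 * bform x y) - (- (2 * bform x (w h)) - h * bform (w h) (w h))
     = 2 * bform x (w h - y) + h * bform (w h) (w h).
    by rewrite bformDr bformNr; ring.
  apply: le_trans (ler_normD _ _) _.
  rewrite !normrM (@ger0_norm _ 2)// (gtr0_norm h0).
  apply: lerD; rewrite ler_pM2l//; first exact: bform_bound.
  have wy : rnorm (w h) <= rnorm y + g h.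
    by rewrite addrC -{1}(subrK y (w h)) rnormD.
  apply: le_trans (bform_bound _ _) _; apply: ler_wpM2l => //.
  by apply: ler_pM => //; exact: rnorm_ge0.
have -> := @cvg_unique _ (@Rhausdorff R) (d @ 0^'+) _ _ _ (@bform_drop x) dE.
by rewrite addrN.
Unshelve. all: by end_near. Qed.

Context (L : linop H).
Hypothesis L_generates : generates L T.

Lemma opdom_add x y : opdom L x -> opdom L y ->
  opdom L (x + y) /\ L (x + y) = L x + L y.
Proof.
move=> Dx Dy; have := opdomP 1 Dx Dy; have := opfunP 1 Dx Dy.
by rewrite !scale1r.
Qed.

Lemma opdom_scale a x : opdom L x -> opdom L (a *: x) /\ L (a *: x) = a *: L x.
Proof.
move=> Dx; have D0 := opdom0 L.
have L0 : L 0 = 0.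
  have := opfunP 1 D0 D0; rewrite !scale1r addr0 => /eqP.
  by rewrite -subr_eq subrr eq_sym => /eqP.
have := opdomP a Dx D0; have := opfunP a Dx D0.
by rewrite L0 !addr0.
Qed.

(** Polarization of the diagonal identity, taken at [x], [y] and [x + y]. *)
Lemma lyapunov_real x y : opdom L x -> opdom L y ->
  bform (L x) y + bform x (L y) = - rip x y.
Proof.
move=> Dx Dy.
have diag z : opdom L z -> 2 * bform z (L z) = - rnorm z ^+ 2.
  by move=> Dz; apply: lyapunov_diag; apply/(L_generates z (L z)).
have [Dxy Lxy] := opdom_add _ _ Dx Dy.
have := diag _ Dxy.
rewrite Lxy bformDl !bformDr (rnorm_sqrD ip ip_norm).
have := diag _ Dx; have := diag _ Dy.
rewrite (bform_sym y (L x)); lra.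
Qed.

(** The integral of [ip (T t x) (T t y)], its imaginary part being expressed as in [Im_ip]. *)
Definition cform x y : R[i] := bform x y +i* bform x ('i *: y).

Lemma cformDl x y z : cform (x + y) z = cform x z + cform y z.
Proof. by rewrite /cform !bformDl. Qed.

(** [bform] is only real-linear; [bform_il] handles the imaginary part of [a]. *)
Lemma cformZl a x y : cform (a *: x) y = a * cform x y.
Proof.
have ii z : 'i *: ('i *: z) = - z :> H by rewrite scalerA -expr2 sqr_i scaleN1r.
rewrite {1}[a]complexE scalerDl cformDl -scalerA.
rewrite /cform !(bformZl, bform_il) ii bformNr.
case: a => a b /=; apply/eqP; rewrite eq_complex /=.
by apply/andP; split; apply/eqP; ring.
Qed.

Lemma cform_conj x y : cform y x = (cform x y)^*.
Proof.
by rewrite /cform /= (bform_sym y x) -bform_il (bform_sym y ('i *: x)).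
Qed.

Lemma cformZr a x y : cform x (a *: y) = a^* * cform x y.
Proof. by rewrite cform_conj cformZl [cform x y]cform_conj (rmorphM conjc). Qed.

Lemma cform_suml n (c : 'I_n -> R[i]) (v : 'I_n -> H) y :
  cform (\sum_i c i *: v i) y = \sum_i c i * cform (v i) y.
Proof.
have c0 : cform 0 y = 0 by rewrite -(scale0r (0 : H)) cformZl mul0r.
rewrite (big_morph (cform^~ y) (fun x z => cformDl x z y) c0).
by apply: eq_bigr => i _; rewrite cformZl.
Qed.

Lemma cform_eq0 x : cform x x = 0 -> x = 0.
Proof. by case=> /bform_eq0. Qed.

(** The real equation at [y] gives the real part, and at ['i *: y] the imaginary part. *)
Lemma lyapunov x y : opdom L x -> opdom L y ->
  cform (L x) y + cform x (L y) = - ip x y.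
Proof.
move=> Dx Dy; have [Diy Liy] := opdom_scale 'i _ Dy.
have hr := lyapunov_real _ _ Dx Dy; have hi := lyapunov_real _ _ Dx Diy.
rewrite Liy in hi; rewrite -Im_ip in hi.
apply/eqP; rewrite eq_complex /= hr hi /rip.
by case: (ip x y) => a b /=; rewrite !eqxx.
Qed.

(** * Gram matrix, normal equations and the minimizer *)

Context (n : nat) (lambda : 'I_n -> R[i]) (xhat : 'I_n -> H).
Hypothesis xhat_eigen : forall j, eigenvector L (lambda j) (xhat j).
Hypothesis xhat_indep : lin_indep xhat.
Hypothesis lambda_lt0 : forall j, complex.Re (lambda j) < 0.

Let comb (xi : 'I_n -> R[i]) : H := \sum_j xi j *: xhat j.

Lemma cform_resolvent x j : opdom L x ->
  cform (L x + (lambda j)^* *: x) (xhat j) = - ip x (xhat j).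
Proof.
case: (xhat_eigen j) => _ Dj Lj Dx.
by rewrite -lyapunov// Lj cformZr cformDl cformZl.
Qed.

Lemma cform_gram i j : cform (xhat i) (xhat j) = - gram ip lambda xhat i j.
Proof.
case: (xhat_eigen i) => _ Di Li.
(* Both real parts are negative, so the denominator of the Gram entry cannot vanish. *)
have l0 : lambda i + (lambda j)^* != 0.
  have := lambda_lt0 i; have := lambda_lt0 j.
  by case: (lambda i) (lambda j) => [a b] [c d] /= c0 a0; apply/eqP => -[]; lra.
rewrite mxE -mulNr -cform_resolvent// Li -scalerDl cformZl mulrAC.
by rewrite divff// mul1r.
Qed.

Lemma cform_comb xi j :
  cform (comb xi) (xhat j) = - \sum_i xi i * gram ip lambda xhat i j.
Proof.
by rewrite cform_suml -sumrN; apply: eq_bigr => i _; rewrite cform_gram mulrN.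
Qed.

Lemma bform_comb_orthogonal z xi : (forall j, cform z (xhat j) = 0) ->
  bform z (comb xi) = 0.
Proof.
move=> zo; suff: cform (comb xi) z = 0 by case; rewrite bform_sym.
rewrite cform_suml big1// => j _.
by rewrite cform_conj zo rmorph0 mulr0.
Qed.

(** The hypothesis is row [j] of the linear system with matrix G^T. The vector [z] may depend on
    [j]: it stands for the resolvent applied to [x0]. *)
Lemma cform_residual z xi j : opdom L z ->
  \sum_i xi i * gram ip lambda xhat i j = ip z (xhat j) ->
  cform (L z + (lambda j)^* *: z - comb xi) (xhat j) = 0.
Proof.
move=> Dz xi_eq; rewrite cformDl -(scaleN1r (comb xi)) cformZl cform_comb.
by rewrite cform_resolvent// xi_eq mulN1r opprK addNr.
Qed.

(** If v G = 0, the combination of the [xhat j] with coefficients v is B-orthogonal to each of them,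
    hence to itself. Definiteness makes it 0, and independence gives v = 0. *)
Lemma gram_unit : gram ip lambda xhat \in unitmx.
Proof.
rewrite unitmxE unitfE; apply/negP => /det0P[v /negP v0 vG]; apply: v0.
have z0 : comb (v ord0) = 0.
  apply: bform_eq0; apply: bform_comb_orthogonal => j.
  have /rowP/(_ j) := vG; rewrite !mxE => vGj.
  by rewrite cform_comb vGj oppr0.
apply/eqP/rowP => j; rewrite mxE; exact: xhat_indep z0 j.
Qed.

(** Integrability makes the extended-real energy finite, so minimizing it is a matter of real
    quadratic forms. *)
Lemma energyE x0 (xi : 'cV[R[i]]_n) :
  let z := x0 - comb (fun j => xi j ord0) in
  energy T xhat x0 xi = (2^-1 * bform z z)%:E.
Proof.
rewrite /energy EFinM; congr (_ * _)%E.
rewrite /bform /Rintegral fineK; last first.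
  apply: integrable_fin_num (integrable_rip_orbit _ _).
  exact: measurable_itv.
by apply: eq_integral => t /mem_halfline t0; rewrite semigroupB// ripxx.
Qed.

(** Pythagoras: the cross term vanishes, so the excess energy at [eta] is half of B(d, d). It is
    nonnegative, and zero only if d = 0, that is, by independence, if [eta] is [xi]. *)
Lemma energy_minimizer x0 (xi : 'cV[R[i]]_n) :
  (forall j, cform (x0 - comb (fun j => xi j ord0)) (xhat j) = 0) ->
  unique (is_minimizer (energy T xhat x0)) xi.
Proof.
move=> ortho.
pose Z (eta : 'cV[R[i]]_n) := x0 - comb (fun j => eta j ord0).
pose d (eta : 'cV[R[i]]_n) := comb (fun j => xi j ord0 - eta j ord0).
have pyth eta :
    bform (Z eta) (Z eta) = bform (Z xi) (Z xi) + bform (d eta) (d eta).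
  have -> : Z eta = Z xi + d eta.
    rewrite /Z /d /comb -addrA; congr (_ + _).
    rewrite -!sumrN -big_split /=; apply: eq_bigr => j _.
    by rewrite scalerBl addrA addNr add0r.
  by rewrite bform_sqrD bform_comb_orthogonal// mulr0 addr0.
have energyZ eta : energy T xhat x0 eta = (2^-1 * bform (Z eta) (Z eta))%:E.
  exact: energyE.
split=> [eta|eta eta_min].
  by rewrite !energyZ lee_fin ler_pM2l ?invr_gt0// (pyth eta) lerDl bform_ge0.
have := eta_min xi; rewrite !energyZ lee_fin ler_pM2l ?invr_gt0// (pyth eta).
rewrite gerDl => d0; have : bform (d eta) (d eta) = 0.
  by apply/eqP; rewrite eq_le d0 bform_ge0.
move=> /bform_eq0/xhat_indep xe; apply/matrixP => i j; rewrite ord1.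
by apply/eqP; rewrite -subr_eq0 xe.
Qed.

End Orbits.

(** * The resolvent at the reflected eigenvalues, and the theorem *)

Lemma inv_shiftP (R : realType) (H : normedModType R[i]) (L : linop H)
    (mu : R[i]) y :
  in_resolvent_set L (- mu) ->
  let x := inv_shift L mu y in opdom L x /\ L x + mu *: x = y.
Proof.
(* A solution exists, so [xget] never returns its default 0. The double sign comes from the
   convention L - mu in [in_resolvent_set]. *)
case=> /(_ y)[x [[Dx Lx] _]] _ /=; rewrite /inv_shift; case: xgetP => //.
by move=> /(_ x); case; split; rewrite // -[X in X *: x]opprK scaleNr.
Qed.

Theorem proposition1 (R : realType) (H : completeNormedModType R[i])
    (ip : {dot H for Num.conj})
    (ip_norm : forall x : H, ip x x = `|x| ^+ 2)
    (L : linop H) (T : R -> H -> H)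
    (L_closed : closed_op L)
    (T_semigroup : C0_semigroup T) (L_generates : generates L T)
    (T_stable : exp_stable T)
    (n : nat) (lambda : 'I_n -> R[i])
    (L_spectrum : slow_spectrum ip L lambda)
    (L_diag : diagonalizable_on L (joint_spectral_subspace ip L lambda))
    (xhat : 'I_n -> H)
    (xhat_eigen : forall j, eigenvector L (lambda j) (xhat j))
    (xhat_indep : lin_indep xhat) :
  let G := gram ip lambda xhat in
  G^T \in unitmx /\
  forall x0 : H, exists xi_min : 'cV[R[i]]_n,
    unique (is_minimizer (energy T xhat x0)) xi_min /\
    forall i, xi_min i ord0 =
      \sum_j invmx G^T i j * ip (inv_shift L (lambda j)^* x0) (xhat j).
Proof.
move=> G.
have [M [omega [omega_gt0 T_stable']]] := T_stable.
have T_bound (t : R) (x : H) :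
    0 <= t -> rnorm (T t x) <= M * expR (- omega * t) * rnorm x.
  move=> t0; have := T_stable' t x t0.
  by rewrite !rnormE -rmorphM /= lecR.
have [spec_lt0 specE _ _ _] := L_spectrum.
have lambda_lt0 j : complex.Re (lambda j) < 0.
  by apply: spec_lt0; rewrite specE; right; exists j.
have G_unit : G \in unitmx.
  exact: (gram_unit ip ip_norm T T_semigroup M omega omega_gt0 T_bound L
    L_generates).
split=> [|x0]; first by rewrite unitmx_tr.
pose b : 'cV[R[i]]_n := \col_j ip (inv_shift L (lambda j)^* x0) (xhat j).
exists (invmx G^T *m b); split; last first.
  by move=> i; rewrite mxE; apply: eq_bigr => j _; rewrite mxE.
apply: (energy_minimizer ip ip_norm T T_semigroup M omega omega_gt0 T_bound)
  => // j.
have [Dz Lz] : let z := inv_shift L (lambda j)^* x0 in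
    opdom L z /\ L z + (lambda j)^* *: z = x0.
  (* The point - lambda_j^* has positive real part, whereas the spectrum lies in the open left
     half-plane. *)
  apply: inv_shiftP; apply: contrapT => /spec_lt0.
  by case: (lambda j) (lambda_lt0 j) => u v /= u0; rewrite oppr_lt0 ltNge ltW.
(* Only the leading [x0] is rewritten; the one inside [b] must stay. *)
rewrite -[x0 in x0 - _]Lz.
apply: (cform_residual ip ip_norm T T_semigroup M omega omega_gt0 T_bound L
  L_generates) => //.
(* Row [j] of this identity is the normal equation required by [cform_residual]. *)
have : G^T *m (invmx G^T *m b) = b by rewrite mulKVmx// unitmx_tr.
move=> /colP/(_ j); rewrite mxE [b j _]mxE => <-.
by apply: eq_bigr => i _; rewrite [G^T j i]mxE mulrC.
Qed.
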